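(* For one or several VIPAs of capacity $\mathrm{Cap}$ operating in tram mode on a directed circuit $C$ whose distinguished origin $v_0$ is the restaurant, the online algorithm $SIF_L$ is $2$-competitive with respect to minimizing the total tour length during the lunch scenario.
   Context: A request is $r_j=(t_j,x_j,y_j,z_j)$: released at time $t_j$ (and only then known to the online algorithm), with origin $x_j$, destination $y_j$ and $z_j$ passengers. VIPAs have capacity $\mathrm{Cap}$ and unit speed. A feasible transportation schedule gives each VIPA one tour starting and ending at $v_0$, carrying every passenger from origin to destination, never serving a request before its release. Total tour length is the sum of tour lengths. In tram mode VIPAs move only along $C$ in its fixed direction and may wait or stop at stations. An online algorithm ALG is $c$-competitive if $ALG(\sigma)\le c\cdot OPT(\sigma)$ for every request sequence $\sigma$, where $OPT(\sigma)$ is the optimal offline total tour length. Lunch scenario: every request has $x_j=v_0$ or $y_j=v_0$. $SIF_L$ (''Start if fully loaded on at least one arc''): each VIPA waits at the restaurant until enough requests are released that, serving them with one VIPA, the VIPA is fully loaded (carries $\mathrm{Cap}$ passengers) on at least one arc of the circuit; then it starts a full round of $C$, stopping at stations where passengers request to enter or leave, and returns to the restaurant.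
   Formalization: Requests are released in a lunch period [0,T] with T known; from T on, SIF_L also starts a round for the remaining passengers when no full load is possible (otherwise they would never be served). Passengers of one request may be split over rounds, and origin differs from destination. *)

(* Defs.v *)
From HB Require Import structures.
From mathcomp Require Import all_boot all_order all_algebra.
From mathcomp Require Import classical_sets reals.
Set Implicit Arguments.
Unset Strict Implicit.
Unset Printing Implicit Defensive.
Import Order.TTheory GRing.Theory Num.Theory.
Local Open Scope ring_scope.

(* The circuit C has stations v_0, ..., v_n, represented by 'I_n.+1, with
   v_0 = ord0.  Arc e goes from station e to station ordS e, and is named after
   its tail.  Speed is 1, so len e is both the length and the travel time of e. *)

Record request (R : realType) (n : nat) := Request {
  release : R;
  orig : 'I_n.+1;
  dest : 'I_n.+1;
  npass : nat }.

Section Fleet.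
Context {R : realType} {n : nat}.
Variables (len : 'I_n.+1 -> R) (k Cap : nat).
Implicit Types (sigma : seq (request R n)).

(* The individual passengers of sigma: pairs (j, i) with i < z_j.  The
   passengers of one request need not travel together. *)
Definition passenger sigma : finType :=
  {j : 'I_(size sigma) & 'I_(npass (tnth (in_tuple sigma) j))}.

Definition req_of sigma (p : passenger sigma) : request R n :=
  tnth (in_tuple sigma) (tag p).

(* A tour is its list of moves in chronological order; the move (d, e) leaves
   station e at time d and traverses arc e, so only moves along C in its fixed
   direction can be written.  Waiting is the slack between arrival and next
   departure. *)
Definition move := (R * 'I_n.+1)%type.
Definition tour := seq move.

Definition arrival (m : move) : R := m.1 + len m.2.

Definition follows (m m' : move) : bool :=
  (m'.2 == ordS m.2) && (arrival m <= m'.1).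

(* The empty tour (a VIPA that never leaves v_0) is allowed. *)
Definition tram_tour (tau : tour) : bool :=
  if tau is m :: tau' then
    [&& m.2 == ord0, 0 <= m.1, path follows m tau'
      & ordS (last m tau').2 == ord0]
  else true.

Definition tour_length (tau : tour) : R := \sum_(m <- tau) len m.2.

(* A passenger boards VIPA vipa just before its move number board and leaves it
   just after its move number alight (both counted from 0 in that tour). *)
Record ride := Ride { vipa : 'I_k; board : nat; alight : nat }.

Record schedule sigma := Schedule {
  tours : 'I_k -> tour;
  rides : passenger sigma -> ride }.

(* In a valid ride, the departure of move number board is the latest possible
   boarding time, hence the comparison with the release date. *)
Definition ride_ok sigma (S : schedule sigma) (p : passenger sigma) : Prop :=
  let r := rides S p in
  let tau := tours S (vipa r) in
  let mv i := nth (0, ord0) tau i in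
  [/\ (board r <= alight r < size tau)%N,
      (mv (board r)).2 = orig (req_of p),
      ordS (mv (alight r)).2 = dest (req_of p)
    & release (req_of p) <= (mv (board r)).1].

Definition onboard sigma (S : schedule sigma) (h : 'I_k) (i : nat) :
    {set passenger sigma} :=
  [set p | (vipa (rides S p) == h)
           && (board (rides S p) <= i <= alight (rides S p))%N].

Definition feasible sigma (S : schedule sigma) : Prop :=
  [/\ forall h, tram_tour (tours S h),
      forall p, ride_ok S p
    & forall h i, (i < size (tours S h))%N -> (#|onboard S h i| <= Cap)%N].

Definition total_length sigma (S : schedule sigma) : R :=
  \sum_(h < k) tour_length (tours S h).

Definition OPT sigma : R :=
  inf [set total_length S | S in [set S : schedule sigma | feasible S]]%classic.

(* An algorithm is given by the schedules it may produce on sigma: choices that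
   its description leaves open are universally quantified in competitive. *)
Definition algorithm := forall sigma, schedule sigma -> Prop.

Definition competitive (adm : seq (request R n) -> Prop) (c : R)
    (ALG : algorithm) : Prop :=
  forall sigma, adm sigma ->
    (exists S, ALG sigma S) /\
    (forall S, ALG sigma S -> feasible S /\ total_length S <= c * OPT sigma).

(* Request sequences released during the lunch period [0, T]. *)
Definition lunch (T : R) sigma : Prop :=
  forall j : 'I_(size sigma), let r := tnth (in_tuple sigma) j in
    [/\ 0 <= release r <= T, orig r != dest r
      & (orig r == ord0) || (dest r == ord0)].

Definition circuit_length : R := \sum_(e < n.+1) len e.

(* A full round starting at v_0 at time s, without waiting. *)
Definition round_moves (s : R) : tour :=
  [seq (s + \sum_(f < n.+1 | (f < e)%N) len f, e) | e : 'I_n.+1 <- enum 'I_n.+1].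

(* Position of the destination along a full round, v_0 being reached again
   after n.+1 arcs. *)
Definition dest_pos sigma (p : passenger sigma) : nat :=
  let y := dest (req_of p) in if y == ord0 then n.+1 else y.

Definition uses sigma (p : passenger sigma) (e : 'I_n.+1) : bool :=
  (orig (req_of p) <= e < dest_pos p)%N.

Definition arc_load sigma (A : {set passenger sigma}) (e : 'I_n.+1) : nat :=
  #|[set p in A | uses p e]|.

Definition fully_loading sigma (A : {set passenger sigma}) : bool :=
  [forall e, (arc_load A e <= Cap)%N] && [exists e, arc_load A e == Cap].

Definition can_fully_load sigma (W : {set passenger sigma}) : bool :=
  [exists A : {set passenger sigma}, (A \subset W) && fully_loading A].

Record round sigma := Round {
  rd_vipa : 'I_k;
  rd_start : R;
  rd_served : {set passenger sigma} }.

Definition waiting sigma (past : seq (round sigma)) (t : R) :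
    {set passenger sigma} :=
  [set p | (release (req_of p) <= t)
           && ~~ has (fun r => p \in rd_served r) past].

Definition idle sigma (past : seq (round sigma)) (h : 'I_k) (t : R) : bool :=
  all (fun r => (rd_vipa r == h) ==> (rd_start r + circuit_length <= t)) past.

(* From T on no request is released any more, so a VIPA no longer waits for a
   full load but also starts for the remaining passengers. *)
Definition starts sigma (T : R) (past : seq (round sigma)) (t : R) : bool :=
  [exists h, idle past h t] &&
  (can_fully_load (waiting past t) || (T <= t) && (0 < #|waiting past t|)%N).

Definition SIF_served sigma (T : R) (past : seq (round sigma)) (t : R)
    (A : {set passenger sigma}) : bool :=
  if can_fully_load (waiting past t)
  then (A \subset waiting past t) && fully_loading A
  else [&& T <= t, A == waiting past t & (0 < #|A|)%N].

(* r is the next round of SIF_L after the rounds in past; the last clause says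
   that it starts as soon as the rule permits. *)
Definition SIF_next sigma (T : R) (past : seq (round sigma))
    (r : round sigma) : Prop :=
  [/\ (0 <= rd_start r) && all (fun q => rd_start q <= rd_start r) past,
      idle past (rd_vipa r) (rd_start r),
      SIF_served T past (rd_start r) (rd_served r)
    & forall t, 0 <= t < rd_start r ->
        all (fun q => rd_start q <= t) past -> ~~ starts T past t].

Definition SIF_run sigma (T : R) (rs : seq (round sigma)) : Prop :=
  (forall rs1 r rs2, rs = rs1 ++ r :: rs2 -> SIF_next T rs1 r) /\
  (forall p : passenger sigma, has (fun r => p \in rd_served r) rs).

Definition run_tour sigma (rs : seq (round sigma)) (h : 'I_k) : tour :=
  flatten [seq round_moves (rd_start r) | r <- rs & rd_vipa r == h].

Definition SIF_L (T : R) : algorithm := fun sigma S =>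
  exists rs : seq (round sigma),
    [/\ SIF_run T rs,
        forall h, tours S h = run_tour rs h
      & forall rs1 r rs2, rs = rs1 ++ r :: rs2 ->
          forall p, p \in rd_served r ->
          let off := size (run_tour rs1 (rd_vipa r)) in
          rides S p = Ride (rd_vipa r) (off + orig (req_of p))%N
                                       (off + (dest_pos p).-1)%N].

End Fleet.

(* Main.v *)
Require Import Defs.
From mathcomp Require Import all_boot all_order all_algebra.
From mathcomp Require Import reals.
From mathcomp Require Import zify lra.
Import Order.TTheory GRing.Theory Num.Theory.
Local Open Scope ring_scope.

(** A tram tour consists of full rounds of the circuit.  In the lunch scenario every
    passenger rides on the first arc (origin [v_0]) or on the last arc
    (destination [v_0]), so [N] rounds carry at most [2 N Cap] passengers.  Each
    round of [SIF_L] carries at least [Cap] passengers, except possibly the last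
    one, which carries at least one; hence [SIF_L] makes at most [2 N] rounds.  *)

Section SIFL.
Set Implicit Arguments.
Unset Strict Implicit.
Unset Printing Implicit Defensive.

(** * Auxiliary facts on sets, sums and sequences *)

Lemma leq_card_bigcup (I : Type) (U : finType) (s : seq I) (F : I -> {set U}) :
  (#|\bigcup_(i <- s) F i| <= \sum_(i <- s) #|F i|)%N.
Proof.
elim/big_rec2: _ => [|i m A _ leAm]; first by rewrite cards0.
by apply: leq_trans (leq_card_setU _ _) _; rewrite leq_add2l.
Qed.

Lemma sum_nat_modn (V : zmodType) (d q : nat) (F : nat -> V) :
  \sum_(0 <= i < q * d.+1) F (i %% d.+1)%N = (\sum_(e < d.+1) F e) *+ q.
Proof.
elim: q => [|q IHq]; first by rewrite big_geq.
rewrite mulSnr (big_cat_nat (n := q * d.+1)) ?leq_addr //= IHq mulrSr.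
congr (_ + _); rewrite -{1}[(q * d.+1)%N]add0n big_addn addKn big_mkord.
by apply: eq_bigr => e _; rewrite addnC modnMDl modn_small.
Qed.

Lemma has_split (U : Type) (a : pred U) s :
  has a s -> exists s1 x s2, s = s1 ++ x :: s2 /\ a x.
Proof.
elim: s => // x s IHs /=; case: (boolP (a x)) => [ax _ | _ /IHs].
  by exists [::], x, s.
by case=> s1 [y [s2 [-> ay]]]; exists (x :: s1), y, s2.
Qed.

(** Compares the positions of two rounds in one run: the first is earlier, later, or the same. *)
Lemma cat_cons_eq (U : Type) (s1 s1' s2 s2' : seq U) x x' :
    s1 ++ x :: s2 = s1' ++ x' :: s2' ->
  [\/ exists s3, s1' = s1 ++ x :: s3, exists s3, s1 = s1' ++ x' :: s3
    | s1 = s1' /\ x = x'].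
Proof.
elim: s1 s1' => [|y s1 IHs] [|y' s1'] /=.
- by case=> -> _; constructor 3.
- by case=> -> _; constructor 1; exists s1'.
- by case=> -> _; constructor 2; exists s1.
case=> -> /IHs[[s3 ->]|[s3 ->]|[-> ->]]; last by constructor 3.
  by constructor 1; exists s3.
by constructor 2; exists s3.
Qed.

(** With [<=] for [e] this yields a minimum, with the converse order a maximum; both are needed to
    pick starting times. *)
Lemma seq_extremum (U : eqType) (e : rel U) (a : pred U) (s : seq U) :
    total e -> transitive e -> has a s ->
  exists c, [/\ c \in s, a c & {in s, forall y, a y -> e c y}].
Proof.
move=> e_total e_trans; elim: s => // x s IHs.
have e_refl y : e y y by have := e_total y y; rewrite orbb.
have [/IHs[c [cs ac c_ext]] _|/hasPn s_na /=] := boolP (has a s); last first.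
  rewrite orbC; case: hasP => [[y /s_na/negP]|_ ax] //.
  exists x; split=> //; first exact: mem_head.
  by move=> y; rewrite inE => /predU1P[->|/s_na/negPf->].
have [/andP[ax exc]|] := boolP (a x && e x c).
  exists x; split=> //; first exact: mem_head.
  by move=> y; rewrite inE => /predU1P[->|/c_ext eyc /eyc]; last exact: e_trans.
rewrite negb_and => x_out; exists c; split=> //; first by rewrite inE cs orbT.
move=> y; rewrite inE => /predU1P[-> ax|/c_ext //].
by move: x_out; rewrite ax /=; have := e_total c x; case: (e x c); rewrite ?orbF.
Qed.

(** * Tram tours as sequences of full rounds *)

Context {R : realType} {n : nat}.
Variables (len : 'I_n.+1 -> R) (len_gt0 : forall e, 0 < len e).

Notation nth0 := (nth (0 : R, ord0 : 'I_n.+1)).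
Implicit Types (tau : @tour R n) (s t : R).

Lemma ordS_eq0 (e : 'I_n.+1) : ordS e = ord0 -> e = n :> nat.
Proof.
move=> /(congr1 val) /=; have := ltn_ord e; rewrite ltnS leq_eqVlt.
by case/predU1P=> // lt_en; rewrite modn_small.
Qed.

Lemma tram_tourP tau :
  reflect [\/ tau = [::]
            | [/\ (0 < size tau)%N, (nth0 tau 0).2 = ord0, 0 <= (nth0 tau 0).1,
                  forall i, (i.+1 < size tau)%N ->
                    follows len (nth0 tau i) (nth0 tau i.+1)
                & ordS (nth0 tau (size tau).-1).2 = ord0]]
          (tram_tour len tau).
Proof.
case: tau => [|m tau]; first by left; left.
rewrite /tram_tour; apply: (iffP and4P) => [[/eqP m0 m_ge0 m_path /eqP mE]|].
  right; split=> //; first by apply/(sortedP (0, ord0)).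
  by rewrite nth_last.
case=> // -[_ /eqP m0 m_ge0 m_path /eqP mE]; split=> //.
  by apply/(sortedP (0, ord0) (s := m :: tau)).
by move: mE; rewrite nth_last.
Qed.

(** The tour leaves from $v_0$ and each move uses the arc after the previous one, so arcs are
    counted modulo $n+1$. *)
Lemma tram_tour_arc tau i :
  tram_tour len tau -> (i < size tau)%N -> (nth0 tau i).2 = (i %% n.+1)%N :> nat.
Proof.
case/tram_tourP=> [->|[_ tau0 _ tauP _]] //.
elim: i => [|i IHi] lti; first by rewrite tau0 mod0n.
have /andP[/eqP-> _] := tauP _ lti.
by rewrite /= IHi 1?ltnW // -addn1 modnDml addn1.
Qed.

(** The last move ends at $v_0$, so its arc is number $n$; hence its index is $n$ modulo $n+1$, and
    the size, one more, is a multiple of $n+1$. *)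
Lemma tram_tour_size tau :
  tram_tour len tau -> size tau = (size tau %/ n.+1 * n.+1)%N.
Proof.
move=> tauT; have := tauT; case/tram_tourP=> [->|[tau_gt0 _ _ _]] //.
move=> /ordS_eq0; rewrite tram_tour_arc ?prednK // => tauE.
have /(congr1 S) := divn_eq (size tau).-1 n.+1.
by rewrite prednK // tauE -addnS -mulSnr => ->; rewrite mulnK.
Qed.

Lemma tram_tour_length tau :
  tram_tour len tau ->
  tour_length len tau = circuit_length len *+ (size tau %/ n.+1).
Proof.
move=> tauT; rewrite /tour_length (big_nth (0, ord0)).
(* The round trip through [inord] turns the index modulo $n+1$ back into an arc, so that the sum
   splits into equal blocks. *)
rewrite (eq_big_nat _ _ (F2 := fun i => len (inord (i %% n.+1)))) => [|i lti].
  rewrite [in LHS](tram_tour_size tauT) (sum_nat_modn _ _ (fun e => len (inord e))).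
  by congr (_ *+ _); apply: eq_bigr => e _; rewrite inord_val.
by congr len; apply/val_inj; rewrite /= inordK ?ltn_pmod // tram_tour_arc.
Qed.

(** Both tours start and end at $v_0$, so only the times at the junction can conflict. *)
Lemma tram_tour_cat tau1 tau2 :
    tram_tour len tau1 -> tram_tour len tau2 ->
    {in tau1 & tau2, forall m1 m2, arrival len m1 <= m2.1} ->
  tram_tour len (tau1 ++ tau2).
Proof.
case: tau1 => [|m1 tau1] //; case: tau2 => [|m2 tau2]; first by rewrite cats0.
rewrite /tram_tour cat_cons => /and4P[m10 m1_ge0 path1 last1].
move=> /and4P[/eqP m20 _ path2 last2] sep.
rewrite m10 m1_ge0 cat_path path1 last_cat /= path2 last2 !andbT /=.
by rewrite /follows m20 eq_sym last1 sep ?mem_last ?mem_head.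
Qed.

(** * The timetable of a round without waiting *)

Lemma size_round_moves s : size (round_moves len s) = n.+1.
Proof. by rewrite size_map size_enum_ord. Qed.

Lemma nth_round_moves s i (e : 'I_n.+1) : e = i :> nat ->
  nth0 (round_moves len s) i = (s + \sum_(f < n.+1 | (f < e)%N) len f, e).
Proof.
move=> <-; rewrite (nth_map ord0) ?size_enum_ord //.
by rewrite nth_ord_enum.
Qed.

Lemma mem_round_moves s m : m \in round_moves len s ->
  m.1 = s + \sum_(f < n.+1 | (f < m.2)%N) len f.
Proof. by case/mapP=> e _ ->. Qed.

Lemma round_moves_arrival s m : m \in round_moves len s ->
  arrival len m = s + \sum_(f < n.+1 | (f < m.2.+1)%N) len f.
Proof.
move=> /mem_round_moves mE; rewrite /arrival mE -addrA; congr (_ + _).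
rewrite [RHS](bigD1 m.2) //= addrC; congr (_ + _).
by apply: eq_bigl => f; rewrite ltnS ltn_neqAle andbC.
Qed.

Lemma round_moves_departure_ge s m : m \in round_moves len s -> s <= m.1.
Proof.
by move=> /mem_round_moves->; rewrite lerDl sumr_ge0 // => f _; apply: ltW.
Qed.

Lemma round_moves_arrival_le s m :
  m \in round_moves len s -> arrival len m <= s + circuit_length len.
Proof.
move=> /round_moves_arrival->; rewrite lerD2l /circuit_length.
by rewrite big_mkcond ler_sum // => f _; case: ifP => // _; apply: ltW.
Qed.

Lemma tram_tour_round_moves s : 0 <= s -> tram_tour len (round_moves len s).
Proof.
move=> s_ge0; apply/tram_tourP; right; rewrite size_round_moves.
have nthE (i : nat) (lt_in : (i < n.+1)%N) :=
  @nth_round_moves s i (Ordinal lt_in) (erefl i).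
split=> //.
- by rewrite nthE //=; apply/val_inj.
- apply: le_trans s_ge0 (round_moves_departure_ge _).
  by rewrite mem_nth // size_round_moves.
- move=> i lti; have lti' := ltnW lti; rewrite /follows (round_moves_arrival (s := s)).
    by rewrite !nthE //= lexx andbT -val_eqE /= modn_small.
  by rewrite mem_nth // size_round_moves.
- by rewrite nthE /=; apply/val_inj; rewrite /= modnn.
Qed.


(** * Counting rounds: cost and capacity *)

Variables (k Cap : nat) (T : R).
Implicit Types (sigma : seq (request R n)).

(** The division is exact for tram tours, by [tram_tour_size]. *)
Definition nb_rounds sigma (S : schedule k sigma) : nat :=
  \sum_(h < k) size (tours S h) %/ n.+1.

Lemma total_length_nb_rounds sigma (S : schedule k sigma) :
    (forall h, tram_tour len (tours S h)) ->
  total_length len S = circuit_length len *+ nb_rounds S.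
Proof.
move=> tramS; rewrite /nb_rounds -sumrMnr; apply: eq_bigr => h _.
exact: tram_tour_length.
Qed.

(** Each round traverses [c] exactly once, with at most [Cap] passengers on board. The function
    [pos] selects, for each passenger of [A], a move of the ride that traverses [c]. *)
Lemma riders_through_arc sigma (S : schedule k sigma) (A : {set passenger sigma})
    (c : 'I_n.+1) (pos : passenger sigma -> nat) :
    feasible len Cap S ->
    {in A, forall p, (board (rides S p) <= pos p <= alight (rides S p))%N
      /\ (nth0 (tours S (vipa (rides S p))) (pos p)).2 = c} ->
  (#|A| <= nb_rounds S * Cap)%N.
Proof.
move=> [tramS ridesS capS] posP.
pose q h := (size (tours S h) %/ n.+1)%N.
(* Move [j * n.+1 + c] is the traversal of [c] in round [j] of VIPA [h]. *)
pose B h := \bigcup_(j < q h) onboard S h (j * n.+1 + c).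
have sAB : A \subset \bigcup_(h < k) B h.
  apply/subsetP=> p /posP[pos_in posc]; have [/andP[_ lt_al] _ _ _] := ridesS p.
  move: pos_in lt_al; set h := vipa _; set i := pos p => /andP[le_bi le_ia] lt_al.
  have lti : (i < size (tours S h))%N := leq_ltn_trans le_ia lt_al.
  have ltq : (i %/ n.+1 < q h)%N.
    by rewrite ltn_divLR // -tram_tour_size.
  apply/bigcupP; exists h => //; apply/bigcupP; exists (Ordinal ltq) => //=.
  rewrite inE eqxx /= -posc (tram_tour_arc (tramS h) lti) -divn_eq.
  by rewrite le_bi.
apply: leq_trans (subset_leq_card sAB) _; apply: leq_trans (leq_card_bigcup _ _) _.
rewrite big_distrl /= leq_sum // => h _; apply: leq_trans (leq_card_bigcup _ _) _.
rewrite -/(q h) -[X in (_ <= X * _)%N]card_ord -sum_nat_const leq_sum // => j _; apply: capS.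
rewrite (tram_tour_size (tramS h)) -/(q h).
have := ltn_ord j; have := ltn_ord c; nia.
Qed.

(** * Demand in the lunch scenario, and waiting passengers *)

Section Lunch.
Variables (sigma : seq (request R n)) (sigmaL : lunch T sigma).
Implicit Types (A W : {set passenger sigma}) (p : passenger sigma).

Lemma lunch_req p :
  [/\ 0 <= release (req_of p) <= T, orig (req_of p) != dest (req_of p)
    & (orig (req_of p) == ord0) || (dest (req_of p) == ord0)].
Proof. exact: sigmaL (tag p). Qed.

(* Every passenger boards before a traversal of the first arc or alights after a
   traversal of the last arc, and both arcs are traversed once per round. *)
Lemma demand_le (S : schedule k sigma) :
  feasible len Cap S -> (#|passenger sigma| <= 2 * nb_rounds S * Cap)%N.
Proof.
move=> feasS; have [tramS ridesS _] := feasS.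
pose Aout := [set p : passenger sigma | orig (req_of p) == ord0].
pose Ain := [set p : passenger sigma | dest (req_of p) == ord0].
have cover_p : [set: passenger sigma] \subset Aout :|: Ain.
  by apply/subsetP=> p _; rewrite !inE; case: (lunch_req p).
rewrite -cardsT; apply: leq_trans (subset_leq_card cover_p) _.
apply: leq_trans (leq_card_setU _ _) _; rewrite -mulnA mul2n -addnn leq_add //.
  apply: (riders_through_arc (c := ord0) (pos := fun p => board (rides S p))) => // p.
  rewrite inE => /eqP p0; have [/andP[leba _] -> _ _] := ridesS p.
  by rewrite leqnn leba.
apply: (riders_through_arc (c := ord_max) (pos := fun p => alight (rides S p))) => // p.
rewrite inE => /eqP p0; have [/andP[leba _] _ pE _] := ridesS p.
rewrite leqnn leba; split=> //; apply/val_inj/ordS_eq0.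
by rewrite pE.
Qed.

(** If at least [Cap] waiting passengers use [e], any [Cap] of them form a fully loading set: [e]
    carries all of them, and no arc can carry more than there are. *)
Lemma can_fully_load_arc W :
  can_fully_load Cap W = [exists e, Cap <= arc_load W e]%N.
Proof.
apply/idP/idP=> [/existsP[A /and3P[sAW _ /existsP[e /eqP AE]]]|/existsP[e leCW]].
  apply/existsP; exists e; rewrite -AE subset_leq_card //.
  by apply/subsetP=> p; rewrite !inE => /andP[/(subsetP sAW)-> ->].
have [A sAW cardA] : exists2 A : {set passenger sigma},
    A \subset [set p in W | uses p e] & #|A| = Cap.
  pose s := take Cap (enum [set p in W | uses p e]).
  exists [set p in s].
    by apply/subsetP=> p; rewrite inE => /mem_take; rewrite mem_enum.
  by rewrite cardsE (card_uniqP _) ?take_uniq ?enum_uniq // size_takel -?cardE.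
apply/existsP; exists A; apply/and3P; split.
- by apply: subset_trans sAW _; apply/subsetP=> p; rewrite inE => /andP[].
- apply/forallP=> f; rewrite -cardA subset_leq_card //.
  by apply/subsetP=> p; rewrite inE => /andP[].
apply/existsP; exists e; rewrite -cardA; apply/eqP/eq_card => p; rewrite inE.
by apply/andb_idr => /(subsetP sAW); rewrite inE => /andP[].
Qed.

Implicit Types (rs past : seq (round k sigma)) (r : round k sigma).

Definition served past : {set passenger sigma} :=
  [set p | has (fun r => p \in rd_served r) past].

Lemma served_rcons past r : served (rcons past r) = served past :|: rd_served r.
Proof. by apply/setP=> p; rewrite !inE has_rcons orbC. Qed.

Lemma waiting_sub_unserved past t : waiting past t \subset ~: served past.
Proof. by apply/subsetP=> p; rewrite !inE => /andP[]. Qed.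

Lemma waiting_unserved past t : T <= t -> waiting past t = ~: served past.
Proof.
move=> leTt; apply/setP=> p; rewrite !inE andb_idl // => _.
by have [/andP[_ /le_trans->]] := lunch_req p.
Qed.

(** * Loads of the rounds of [SIF_L] and the number of rounds *)

Hypothesis Cap_gt0 : (0 < Cap)%N.

Lemma SIF_served_waiting past t A :
  SIF_served Cap T past t A -> A \subset waiting past t.
Proof. by rewrite /SIF_served; case: ifP => _ /andP[] // _ /andP[/eqP->]. Qed.

(** A round that starts without a full load takes everybody waiting, but then every arc has load
    below [Cap] by [can_fully_load_arc]. *)
Lemma SIF_served_load past t A e :
  SIF_served Cap T past t A -> (arc_load A e <= Cap)%N.
Proof.
rewrite /SIF_served; case: ifPn => [_ /and3P[_ /forallP->]|] //.
rewrite can_fully_load_arc negb_exists => /forallP/(_ e).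
by rewrite -ltnNge => /ltnW leW /and3P[_ /eqP-> _].
Qed.

Lemma fully_loading_card A : fully_loading Cap A -> (Cap <= #|A|)%N.
Proof.
case/andP=> _ /existsP[e /eqP<-]; apply: subset_leq_card.
by apply/subsetP=> p; rewrite inE => /andP[].
Qed.

Lemma SIF_served_gt0 past t A : SIF_served Cap T past t A -> (0 < #|A|)%N.
Proof.
rewrite /SIF_served; case: ifP => _; last by case/and3P.
by case/andP=> _ /fully_loading_card; apply: leq_trans.
Qed.

Lemma SIF_served_full past t A :
  SIF_served Cap T past t A -> (Cap <= #|A|)%N \/ ~: served past \subset A.
Proof.
rewrite /SIF_served; case: ifP => _.
  by case/andP=> _ /fully_loading_card; left.
by case/and3P=> leTt /eqP-> _; right; rewrite waiting_unserved.
Qed.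

(** The condition of [SIF_run] on single rounds, without the demand that everybody be served: it
    passes to prefixes, which permits induction on the last round. *)
Definition SIF_prefix rs : Prop :=
  forall rs1 r rs2, rs = rs1 ++ r :: rs2 -> SIF_next len Cap T rs1 r.

Lemma SIF_prefix_rcons rs r :
  SIF_prefix (rcons rs r) <-> SIF_prefix rs /\ SIF_next len Cap T rs r.
Proof.
split=> [rsP|[rsP rP] rs1 r' rs2].
  split=> [rs1 r' rs2 rsE|]; last by apply: (rsP _ _ [::]); rewrite cats1.
  by apply: (rsP _ _ (rcons rs2 r)); rewrite rsE rcons_cat.
case/lastP: rs2 => [|rs2 r2]; first by rewrite cats1 => /rcons_inj[<- <-].
by rewrite -rcons_cons -rcons_cat => /rcons_inj[/rsP].
Qed.

Lemma served_rcons_card past t r : SIF_served Cap T past t (rd_served r) ->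
  #|served (rcons past r)| = (#|served past| + #|rd_served r|)%N.
Proof.
move=> /SIF_served_waiting rW; rewrite served_rcons.
rewrite cardsU; suff /eqP-> : served past :&: rd_served r == set0.
  by rewrite cards0 subn0.
rewrite setI_eq0 disjoint_sym disjoints_subset.
exact: subset_trans rW (waiting_sub_unserved _ _).
Qed.

(* A round that is not fully loaded takes everybody, hence it is the last one. *)
Lemma SIF_prefix_full rs r :
  SIF_prefix (rcons rs r) -> (size rs * Cap <= #|served rs|)%N.
Proof.
elim/last_ind: rs r => [|rs r' IHrs] r // /SIF_prefix_rcons[rsP [_ _ rS _]].
have /SIF_prefix_rcons[_ [_ _ r'S _]] := rsP.
rewrite size_rcons (served_rcons_card r'S) mulSnr.
rewrite leq_add ?(IHrs _ rsP) //; have [//|all_served] := SIF_served_full r'S.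
(* If [r'] took all unserved passengers, nobody would be left for [r], which serves at least one. *)
have := SIF_served_gt0 rS; rewrite card_gt0 => /set0Pn[p].
move=> /(subsetP (SIF_served_waiting rS))/(subsetP (waiting_sub_unserved _ _)).
rewrite served_rcons setCU inE => /andP[/(subsetP all_served)].
by rewrite [in X in _ -> X]inE => ->.
Qed.

(** The last round serves at least one further passenger, so the number of earlier rounds times
    [Cap] is strictly below the demand. This strictness pays for the last round after division by
    [Cap]. *)
Lemma SIF_nb_rounds rs (S : schedule k sigma) :
  SIF_prefix rs -> feasible len Cap S -> (size rs <= 2 * nb_rounds S)%N.
Proof.
case/lastP: rs => // rs r rsP /demand_le leP.
have /SIF_prefix_rcons[_ [_ _ rS _]] := rsP.
rewrite size_rcons -(ltn_pmul2r Cap_gt0); apply: leq_trans leP.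
apply: leq_ltn_trans (SIF_prefix_full rsP) _.
apply: leq_trans (max_card (mem (served (rcons rs r)))).
by rewrite (served_rcons_card rS) -addn1 leq_add2l (SIF_served_gt0 rS).
Qed.

(** * The tours of a run and their feasibility *)

Lemma run_tour_cat rs1 rs2 h :
  run_tour len (rs1 ++ rs2) h = run_tour len rs1 h ++ run_tour len rs2 h.
Proof. by rewrite /run_tour filter_cat map_cat flatten_cat. Qed.

Lemma run_tour_cons r rs h : run_tour len (r :: rs) h =
  (if rd_vipa r == h then round_moves len (rd_start r) else [::])
    ++ run_tour len rs h.
Proof. by rewrite /run_tour /=; case: ifP. Qed.

Lemma size_run_tour rs h :
  size (run_tour len rs h) = (count (fun r => rd_vipa r == h) rs * n.+1)%N.
Proof.
elim: rs => // r rs IHrs; rewrite run_tour_cons size_cat IHrs mulnDl /=.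
by case: ifP; rewrite ?size_round_moves ?mul1n.
Qed.

Lemma nb_rounds_run rs (S : schedule k sigma) :
  (forall h, tours S h = run_tour len rs h) -> nb_rounds S = size rs.
Proof.
move=> toursE; rewrite /nb_rounds.
rewrite (eq_bigr (fun h => count (fun r => rd_vipa r == h) rs)) => [|h _]; last first.
  by rewrite toursE size_run_tour mulnK.
elim: rs {toursE} => [|r rs IHrs]; first by rewrite big1.
rewrite big_split /= IHrs (bigD1 (rd_vipa r)) //= eqxx big1 // => h.
by rewrite eq_sym => /negPf->.
Qed.

Lemma idle_arrival past h t m :
  idle len past h t -> m \in run_tour len past h -> arrival len m <= t.
Proof.
elim: past => [|r past IHpast] // /andP[r_idle past_idle].
rewrite run_tour_cons mem_cat => /orP[|/IHpast]; last exact.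
case: eqP r_idle => // _ /(le_trans (round_moves_arrival_le _)) le_t.
exact: le_t.
Qed.

(** A VIPA starts only when idle, hence after the arrival of all its earlier moves. *)
Lemma tram_tour_run rs h :
  SIF_prefix rs -> tram_tour len (run_tour len rs h).
Proof.
elim/last_ind: rs => // rs r IHrs /SIF_prefix_rcons[/IHrs tramT [/andP[r_ge0 _] rI _ _]].
rewrite -cats1 run_tour_cat run_tour_cons cats0.
case: eqP => [rh|_]; last by rewrite cats0.
rewrite rh in rI; apply: tram_tour_cat (tram_tour_round_moves r_ge0) _ => //.
move=> m1 m2 /(idle_arrival rI) le1 /round_moves_departure_ge.
exact: le_trans.
Qed.

(** A lunch ride never passes through $v_0$ on its way, so it fits into a single round. *)
Lemma orig_lt_dest_pos p : (orig (req_of p) < dest_pos p)%N.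
Proof.
have [_ _] := lunch_req p; rewrite /dest_pos.
by have [_ //|d_n0] := eqVneq (dest _) ord0; rewrite orbF => /eqP->; rewrite lt0n.
Qed.

Lemma dest_pos_le p : (dest_pos p <= n.+1)%N.
Proof. by rewrite /dest_pos; case: eqP => // _; apply: ltnW. Qed.

Lemma ordS_dest_pos p (e : 'I_n.+1) :
  e = (dest_pos p).-1 :> nat -> ordS e = dest (req_of p).
Proof.
move=> eE; apply/val_inj; rewrite /= eE prednK; last first.
  exact: leq_ltn_trans (orig_lt_dest_pos p).
rewrite /dest_pos; case: eqP => [->|_]; first by rewrite modnn.
by rewrite modn_small.
Qed.

Lemma SIF_feasible (S : schedule k sigma) :
  SIF_L len Cap T S -> feasible len Cap S.
Proof.
case=> rs [[rsP rs_all] toursE ridesE].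
have ride_of p : exists rs1 r rs2, rs = rs1 ++ r :: rs2 /\ p \in rd_served r.
  exact: has_split (rs_all p).
split=> [h|p|h i _].
- by rewrite toursE; apply: tram_tour_run.
- have [rs1 [r [rs2 [rsE rp]]]] := ride_of p.
  have [_ _ /SIF_served_waiting/subsetP/(_ _ rp)] := rsP _ _ _ rsE.
  rewrite inE => /andP[le_rel _] _.
  have lt_od := orig_lt_dest_pos p; have le_d := dest_pos_le p.
  rewrite /ride_ok (ridesE _ _ _ rsE _ rp) /= toursE rsE run_tour_cat run_tour_cons.
  rewrite eqxx; set off := size _; set tl := run_tour len rs2 _.
  (* In the tour of its VIPA, round [r] occupies the moves from [off] to [off + n]. *)
  have nthE j : (j < n.+1)%N -> nth0 (run_tour len rs1 (rd_vipa r)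
      ++ round_moves len (rd_start r) ++ tl) (off + j) =
      nth0 (round_moves len (rd_start r)) j.
    by move=> ltj; rewrite nth_cat ltnNge leq_addr addKn nth_cat size_round_moves ltj.
  have lt_dp : ((dest_pos p).-1 < n.+1)%N by lia.
  rewrite !nthE //; split.
  + by rewrite !size_cat size_round_moves -/off; lia.
  + by rewrite (nth_round_moves _ (e := orig (req_of p))).
  + by rewrite (nth_round_moves _ (e := Ordinal lt_dp)) //; apply: ordS_dest_pos.
  apply: le_trans le_rel (round_moves_departure_ge _).
  by rewrite mem_nth // size_round_moves.
(* For capacity, one passenger [p0] on board at move [i] identifies the round [r] containing that
   move. It remains to see that everybody on board then is served by [r] and uses arc [i - off],
   whose load is at most [Cap]. *)
have [->|[p0]] := set_0Vmem (onboard S h i); first by rewrite cards0.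
rewrite inE => /andP[/eqP hE].
have [rs1 [r [rs2 [rsE rp0]]]] := ride_of p0.
rewrite (ridesE _ _ _ rsE _ rp0) /= in hE *; rewrite hE.
set off := size _ => p0_i.
have off_next rs3 : (off + n.+1 <= size (run_tour len (rs1 ++ r :: rs3) h))%N.
  rewrite run_tour_cat run_tour_cons hE eqxx !size_cat size_round_moves -/off.
  by rewrite addnA leq_addr.
have lt_e : (i - off < n.+1)%N by have := dest_pos_le p0; lia.
have [_ _ /(SIF_served_load (Ordinal lt_e)) + _] := rsP _ _ _ rsE.
apply: leq_trans; apply/subset_leq_card/subsetP=> p.
rewrite [in X in X -> _]inE => /andP[/eqP].
have [rs1' [r' [rs2' [rsE' rp]]]] := ride_of p.
rewrite (ridesE _ _ _ rsE' _ rp) /= => hE'; rewrite hE' => p_i.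
have := dest_pos_le p; have := dest_pos_le p0.
have := orig_lt_dest_pos p; have := orig_lt_dest_pos p0.
(* Distinct rounds of one VIPA occupy disjoint blocks of $n+1$ moves, so a later or earlier round
   cannot contain move [i]. *)
have [[rs3 rs1E]|[rs3 rs1E]|[rs1E rE]] := cat_cons_eq (etrans (esym rsE) rsE').
- by have := off_next rs3; rewrite -rs1E; lia.
- have : (size (run_tour len rs1' h) + n.+1 <= off)%N.
    rewrite /off rs1E run_tour_cat run_tour_cons hE' eqxx !size_cat.
    by rewrite size_round_moves addnA leq_addr.
  by lia.
by rewrite !inE rE rp /uses /=; move: p_i; rewrite -rs1E -/off; lia.
Qed.

(** * Existence of runs *)

Lemma all_le_congr (U : Type) (f : U -> R) (a : U -> bool -> bool) t c (s : seq U) :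
    {in [seq f x | x <- s], forall y, (y <= t) = (y <= c)} ->
  all (fun x => a x (f x <= t)) s = all (fun x => a x (f x <= c)) s.
Proof.
elim: s => //= x s IHs eq_tc; rewrite eq_tc ?mem_head // IHs // => y ys.
by rewrite eq_tc // inE ys orbT.
Qed.

(* The rule of SIF_L compares the current time with these values only, so its
   truth value changes at these times only. *)
Definition event_times past : seq R :=
  0 :: T :: [seq release (req_of p) | p in passenger sigma]
    ++ [seq rd_start r | r <- past]
    ++ [seq rd_start r + circuit_length len | r <- past].

Definition may_start past t : bool :=
  [&& 0 <= t, all (fun q => rd_start q <= t) past & starts len Cap T past t].

Lemma may_start_congr past t c :
    {in event_times past, forall x, (x <= t) = (x <= c)} ->
  may_start past t = may_start past c.
Proof.
move=> eq_tc.
have eq_start : {in [seq rd_start r | r <- past], forall x, (x <= t) = (x <= c)}.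
  by move=> x xs; apply: eq_tc; rewrite !inE !mem_cat xs !orbT.
have eq_end : {in [seq rd_start r + circuit_length len | r <- past],
    forall x, (x <= t) = (x <= c)}.
  by move=> x xs; apply: eq_tc; rewrite !inE !mem_cat xs !orbT.
have eq_wait : waiting past t = waiting past c.
  apply/setP=> p; rewrite !inE eq_tc // !inE mem_cat.
  by rewrite (image_f (fun p => release (req_of p))) ?orbT.
have eq_idle h : idle len past h t = idle len past h c.
  exact: (all_le_congr (fun r b => (rd_vipa r == h) ==> b) eq_end).
rewrite /may_start /starts eq_wait !eq_tc ?inE ?eqxx ?orbT //.
rewrite (all_le_congr (fun _ b => b) eq_start).
by under eq_existsb do rewrite eq_idle.
Qed.

Hypothesis k_gt0 : (0 < k)%N.

(** Time is continuous, but the rule changes only at finitely many event times, so there is an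
    earliest time at which a round may start. *)
Lemma SIF_next_exists past :
  ~: served past != set0 -> exists r, SIF_next len Cap T past r.
Proof.
move=> unserved; have ge_total : total (fun x y : R => y <= x).
  by move=> x y; apply: le_total.
have ge_trans : transitive (fun x y : R => y <= x).
  by move=> y x z /[swap]; apply: le_trans.
have [|c [_ _ c_max]] :=
  seq_extremum (a := predT) (s := event_times past) ge_total ge_trans.
  by [].
(* At the latest event time [c], the period is over and all past rounds have ended, so a VIPA is
   idle and may leave with the unserved passengers. *)
have c_ok : may_start past c.
  have le_Tc : T <= c by apply: c_max => //; rewrite !inE eqxx orbT.
  have le_end : all (fun q => rd_start q + circuit_length len <= c) past.
    rewrite -(all_map _ (fun x => x <= c)); apply/allP=> x xs.
    by apply: c_max => //; rewrite !inE !mem_cat xs !orbT.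
  apply/and3P; split; first by apply: c_max => //; rewrite mem_head.
    rewrite -(all_map _ (fun x => x <= c)); apply/allP=> x xs.
    by apply: c_max => //; rewrite !inE !mem_cat xs !orbT.
  rewrite /starts le_Tc waiting_unserved // card_gt0 unserved orbT andbT.
  apply/existsP; exists (Ordinal k_gt0); apply: sub_all le_end => q le_qc.
  exact/implyP.
(* Round [t] down to the latest event time not after it; the event time 0 guarantees that there is
   one. *)
have may_start_event t : may_start past t ->
    exists2 x, x \in event_times past & (x <= t) && may_start past x.
  move=> t_ok; have [t_ge0 _ _] := and3P t_ok.
  have [|x [x_ev le_xt x_max]] := seq_extremum (a := fun x => x <= t)
      (s := event_times past) ge_total ge_trans.
    by rewrite /= t_ge0.
  exists x => //; rewrite le_xt (may_start_congr (c := t)) // => y y_ev.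
  by apply/idP/idP=> [/le_trans->|/(x_max _ y_ev)].
have [x x_ev /andP[_ x_ok]] := may_start_event c c_ok.
have [|s [s_ev s_ok s_min]] := seq_extremum (e := <=%R) (a := may_start past)
    (s := event_times past) (@le_total _ _) le_trans.
  by apply/hasP; exists x.
have /and3P[s_ge0 s_past /andP[/existsP[h h_idle] s_load]] := s_ok.
have [A A_served] : exists A, SIF_served Cap T past s A.
  have [W_full|/negPf W_nfull] := boolP (can_fully_load Cap (waiting past s)).
    by have /existsP[A] := W_full; exists A; rewrite /SIF_served W_full.
  move: s_load; rewrite W_nfull => /andP[leTs w_gt0].
  by exists (waiting past s); rewrite /SIF_served W_nfull leTs eqxx.
exists (Round h s A); split=> //=; first by rewrite s_ge0.
(* An earlier start would round down to an admissible event time before [s], against the minimality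
   of [s]. *)
move=> t /andP[t_ge0 lt_ts] t_past; apply/negP=> t_starts.
have [|y y_ev /andP[le_yt /s_min]] := may_start_event t; first exact/and3P.
by move=> /(_ y_ev) le_sy; have := le_lt_trans (le_trans le_sy le_yt) lt_ts; rewrite ltxx.
Qed.

Lemma SIF_run_exists : exists rs, SIF_run (k := k) (sigma := sigma) len Cap T rs.
Proof.
have nil_ok : SIF_prefix [::] by case.
(* The empty run is generalized to any prefix, for induction on the number of unserved passengers:
   each further round lowers it. *)
move: nil_ok; move: [::] => rs; have [m] := ubnP #|~: served rs|.
elim: m rs => // m IHm rs le_m rsP.
have [all_served|/SIF_next_exists[r rN]] := eqVneq (~: served rs) set0.
  exists rs; split=> // p; have : p \notin ~: served rs by rewrite all_served inE.
  by rewrite !inE negbK.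
apply: (IHm (rcons rs r)); last exact/SIF_prefix_rcons.
have [_ _ rS _] := rN; move: le_m (SIF_served_gt0 rS).
have := cardsC (served rs); have := cardsC (served (rcons rs r)).
by rewrite (served_rcons_card rS); lia.
Qed.

Lemma SIF_L_exists : exists S : schedule k sigma, SIF_L len Cap T S.
Proof.
have [rs [rsP rs_all]] := SIF_run_exists.
(* A mere default for [nth]: every passenger is served by some round, so [pos p] is a valid
   index. *)
pose r0 : round k sigma := Round (Ordinal k_gt0) 0 set0.
pose pos p := find (fun r => p \in rd_served r) rs.
pose rd p := nth r0 rs (pos p).
pose off p := size (run_tour len (take (pos p) rs) (rd_vipa (rd p))).
exists (Schedule (run_tour len rs) (fun p => Ride (rd_vipa (rd p))
  (off p + orig (req_of p)) (off p + (dest_pos p).-1))).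
exists rs; split=> // rs1 r rs2 rsE p rp /=.
have [_ _ /SIF_served_waiting/subsetP/(_ _ rp)] := rsP _ _ _ rsE.
rewrite inE => /andP[_ /negPf rs1p] _.
(* Passenger [p] was still waiting when [r] started, so [r] is the first round found. *)
have posE : pos p = size rs1 by rewrite /pos rsE find_cat rs1p /= rp addn0.
by rewrite /off /rd posE rsE nth_cat ltnn subnn take_size_cat.
Qed.

(** * The competitive ratio *)

Lemma SIF_L_cost (S : schedule k sigma) :
  SIF_L len Cap T S -> total_length len S <= 2 * OPT len k Cap sigma.
Proof.
move=> S_SIF; have feasS := SIF_feasible S_SIF; have [tramS _ _] := feasS.
have [rs [[rsP _] toursE _]] := S_SIF.
(* Half the cost is to be a lower bound of the costs of feasible schedules. The infimum is over a
   nonempty set, since [S] itself is feasible. *)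
suff : total_length len S / 2 <= OPT len k Cap sigma by lra.
apply: lb_le_inf; first by exists (total_length len S), S.
move=> _ [S' feasS' <-]; have [tramS' _ _] := feasS'.
have := SIF_nb_rounds rsP feasS'; rewrite -(nb_rounds_run toursE) => le_rounds.
rewrite ler_pdivrMr // !total_length_nb_rounds // mulr_natr -mulrnA mulnC.
by rewrite ler_wpMn2l // sumr_ge0 // => e _; apply: ltW.
Qed.

End Lunch.
End SIFL.

Theorem theorem4 (R : realType) (n : nat) (len : 'I_n.+1 -> R) (k Cap : nat)
    (T : R) (len_gt0 : forall e, 0 < len e)
    (k_gt0 : (0 < k)%N) (Cap_gt0 : (0 < Cap)%N) :
  competitive len Cap (lunch T) 2 (SIF_L (k := k) len Cap T).
Proof.
move=> sigma sigmaL; split; first exact: SIF_L_exists.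
by move=> S S_SIF; split; [apply: SIF_feasible S_SIF | apply: SIF_L_cost S_SIF].
Qed.
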